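(* Let $m$ be a non-negative integer, let $q,n\in\mathbb{N}$ with $n\ge q$, and let $a_N$ be a sequence of complex numbers defined for integers $N$ in $[q,n]$. Then $$\sum_{q\le N_1<\cdots<N_m\le n}a_{N_m}\cdots a_{N_1}=(-1)^m\sum_{\substack{(y_1,\ldots,y_m)\\ \sum i y_i=m}}\ \prod_{i=1}^{m}\frac{(-1)^{y_i}}{y_i!}\left(\frac1i\sum_{N=q}^{n}(a_N)^i\right)^{y_i},$$ where the outer sum on the right runs over all partitions of $m$.
   Context: $\mathbb{N}=\{0,1,2,\ldots\}$. A partition of $m$ is represented by the tuple $(y_1,\ldots,y_m)$ of non-negative integers with $\sum_{i=1}^m i\,y_i=m$, where $y_i$ is the multiplicity of the part $i$. For $m=0$ there is exactly one partition, the empty one. Empty products equal $1$ and $0^0=1$. The sum on the left ranges over strictly increasing $m$-tuples of integers in $[q,n]$. It equals $1$ if $m=0$ and $0$ if $m>n-q+1$. *)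

(* Defs.v *)
From mathcomp Require Import all_boot all_order all_algebra.
From mathcomp Require Import reals complex.

Set Implicit Arguments.
Unset Strict Implicit.
Unset Printing Implicit Defensive.

Import GRing.Theory.
Local Open Scope ring_scope.

(* Strictly increasing m-tuples
   q <= N_1 < ... < N_m <= n.  The upper bound is carried by the type 'I_n.+1. *)
Definition increasing_in (q n m : nat) (N : m.-tuple 'I_n.+1) : bool :=
  sorted ltn [seq val k | k <- N] && all (fun k : 'I_n.+1 => (q <= k)%N) N.

(* A partition of m is given by multiplicities: y i, with i : 'I_m counted from
   0, is the multiplicity y_{i+1} of the part i+1.  Bounding the multiplicities
   by m, which makes the index set finite, loses nothing: see
   partition_mult_le. *)
Definition is_partition (m : nat) (y : {ffun 'I_m -> 'I_m.+1}) : bool :=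
  (\sum_(i < m) i.+1 * y i == m)%N.

Lemma partition_mult_le (m : nat) (y : 'I_m -> nat) :
  (\sum_(i < m) i.+1 * y i)%N = m -> forall i, (y i <= m)%N.
Proof.
move=> ym i; rewrite -[leqRHS]ym (bigD1 i) //=.
by rewrite mulSn -addnA leq_addr.
Qed.

(* Main.v *)
Require Import Defs.
From mathcomp Require Import all_boot all_order all_algebra.
From mathcomp Require Import reals complex.

Set Implicit Arguments.
Unset Strict Implicit.
Unset Printing Implicit Defensive.

Import GRing.Theory.
Local Open Scope ring_scope.
Local Open Scope complex_scope.

(** The identity is the coefficient of [X^m] in the power series equation
      [\prod_N (1 - a_N X) = \prod_(i >= 1) exp (- p_i X^i / i)],
    where [p_i] is the sum of the [a_N ^+ i].  Expanding the product on the
    left gives, up to the sign [(-1) ^+ m], the sum of the products of [m] of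
    the [a_N] at distinct indices ([coef_prod_one_subX],
    [sum_sorted_tuples_subsets]); expanding the exponentials and collecting
    the terms of degree [m] gives the sum over the partitions of [m], the
    multiplicity of the part [i] being the exponent chosen in the [i]-th
    exponential series ([coef_prod_exp_trunc]).

    To prove the equation, compare logarithmic derivatives.  On the left each
    factor contributes the geometric series
    [- a / (1 - a X) = - \sum_k a ^+ k.+1 X^k], hence [- p_(k+1)] in total at
    [X^k]; on the right the factor [exp (- p_i X^i / i)] contributes
    [- p_i X^(i-1)].  So both sides solve the same linear differential equation
    [T' = G T] with constant term [1], and in characteristic zero such a
    solution is unique.

    All this is carried out with polynomials: the exponential series are cut
    at degree [m], only the parts [i <= m] are kept, and [T' = G T] is required
    modulo [X^m], which still determines the coefficients of [T] up to that of
    [X^m] ([log_deriv_mod_coef]). *)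

(** This is [t^`() / t = g] modulo ['X^m], without the division. *)
Definition log_deriv_mod (R : comNzRingType) (m : nat) (g t : {poly R}) :
    Prop :=
  exists r : {poly R}, t^`() = g * t + 'X^m * r.

(** The Leibniz rule: logarithmic derivatives turn products into sums. *)
Lemma log_deriv_mod_prod (R : comNzRingType) (m : nat) (I : finType)
    (g t : I -> {poly R}) :
  (forall i, log_deriv_mod m (g i) (t i)) ->
  log_deriv_mod m (\sum_i g i) (\prod_i t i).
Proof.
move=> gt; apply: (big_ind2 (log_deriv_mod m)) => [||i _]; last exact: gt.
  by exists 0; rewrite derivC mul0r mulr0 addr0.
move=> g1 t1 g2 t2 [r1 d1] [r2 d2]; exists (r1 * t2 + t1 * r2).
rewrite derivM d1 d2 !mulrDl !mulrDr !mulrA.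
by rewrite [t1 * g2]mulrC [t1 * 'X^m]mulrC addrACA.
Qed.

(** The equation [p^`() = g * p] modulo ['X^m] expresses
    [k.+1%:R * p`_k.+1], for [k < m], through the coefficients of [p] of index
    at most [k]; in characteristic zero it thus computes [p] from its
    constant term. *)
Lemma log_deriv_mod_coef (R : numFieldType) (m : nat) (g p r : {poly R}) :
  log_deriv_mod m g p -> log_deriv_mod m g r -> p`_0 = r`_0 -> p`_m = r`_m.
Proof.
move=> [s dp] [u dr] pr0.
suff eq_le k : (k <= m)%N -> p`_k = r`_k by exact: eq_le.
have [N] := ubnP k; elim: N k => // N IHN [|k] // leN ltkm.
apply: (Num.Theory.pmulrnI (ltn0Sn k)); rewrite /= -!coef_deriv dp dr.
rewrite !coefD !coefXnM ltkm !addr0 !coefM; apply: eq_bigr => i _.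
rewrite IHN // ?(leq_ltn_trans (leq_subr _ _)) //.
exact: leq_trans (leq_subr _ _) (ltnW ltkm).
Qed.

Definition exp_trunc (R : numFieldType) (m : nat) (p : {poly R}) : {poly R} :=
  \sum_(j < m.+1) j`!%:R^-1 *: p ^+ j.

(** Differentiating the truncated exponential loses exactly its top term
    [p ^+ m / m`!], which vanishes modulo ['X^m] as soon as ['X] divides
    [p]. *)
Lemma log_deriv_exp_trunc (R : numFieldType) (m : nat) (p : {poly R}) :
  p`_0 = 0 -> log_deriv_mod m p^`() (exp_trunc m p).
Proof.
move=> p0; have [s ps] : exists s, p = 'X * s.
  exists (p %/ 'X); rewrite mulrC divpK //.
  by rewrite -['X]subr0 -[0]polyC0 dvdp_XsubCl /root horner_coef0 p0.
exists (- (m`!%:R^-1 *: (p^`() * s ^+ m))).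
have -> : (exp_trunc m p)^`() = p^`() * \sum_(j < m) j`!%:R^-1 *: p ^+ j.
  rewrite /exp_trunc big_ord_recl derivD expr0 derivZ derivC scaler0 add0r.
  rewrite raddf_sum mulr_sumr; apply: eq_bigr => j _.
  rewrite /= derivZ deriv_exp /= /bump /= add1n -scaler_nat scalerA -scalerAr.
  rewrite factS natrM invfM mulrAC mulVf ?mul1r //.
  by rewrite Num.Theory.pnatr_eq0.
rewrite [in RHS]/exp_trunc big_ord_recr /= mulrDr -addrA -[LHS]addr0.
congr (_ + _); apply/esym/eqP; rewrite mulrN subr_eq0 -!scalerAr.
by rewrite [in p ^+ m]ps exprMn mulrCA.
Qed.

(** The finite geometric sum inverts [1 - c *: 'X] modulo ['X^m]. *)
Lemma log_deriv_geometric (R : comNzRingType) (m : nat) (c : R) :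
  log_deriv_mod m (- \sum_(k < m) c ^+ k.+1 *: 'X^k) (1 - c *: 'X).
Proof.
exists (- (c ^+ m.+1)%:P).
have -> : \sum_(k < m) c ^+ k.+1 *: 'X^k = c%:P * \sum_(k < m) (c *: 'X) ^+ k.
  rewrite mulr_sumr; apply: eq_bigr => k _.
  by rewrite exprZn mul_polyC scalerA exprS.
rewrite -[X in _ * X + _]opprB mulrNN -mulrA [_ * (_ - 1)]mulrC -subrX1.
rewrite derivB derivZ derivX derivC sub0r alg_polyC exprZn mulrBr mulr1.
rewrite mulrN mul_polyC scalerA -exprS -mul_polyC.
by rewrite [_ * 'X^m]mulrC addrAC subrr sub0r.
Qed.

Lemma coef_prod_one_subX (R : comNzRingType) (I : finType) (b : I -> R) m :
  (\prod_i (1 - b i *: 'X))`_m =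
  (-1) ^+ m * \sum_(A : {set I} | #|A| == m) \prod_(i in A) b i.
Proof.
under eq_bigr do rewrite addrC.
rewrite bigA_distr coef_sum mulr_sumr [RHS]big_mkcond; apply: eq_bigr => A _.
rewrite -big_mkcond /=.
have -> : \prod_(i in A) - (b i *: 'X) =
    ((-1) ^+ #|A| * \prod_(i in A) b i) *: 'X^#|A|.
  under eq_bigr do rewrite -scaleNr.
  by rewrite scaler_prod prodrN prodr_const.
rewrite coefZ coefXn eq_sym.
by case: eqP => [->|_]; rewrite ?mulr1 ?mulr0.
Qed.

(** Choosing the term of exponent [y i] in the [i]-th exponential contributes
    [i.+1 * y i] to the degree, so the choices that reach degree [m] are the
    partitions of [m]. *)
Lemma coef_prod_exp_trunc (R : numFieldType) (x : nat -> R) m :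
  (\prod_(i < m) exp_trunc m (x i *: 'X^(i.+1)))`_m =
  \sum_(y : {ffun 'I_m -> 'I_m.+1} | is_partition y)
    \prod_(i < m) ((y i)`!%:R^-1 * x i ^+ y i).
Proof.
rewrite bigA_distr_bigA coef_sum [RHS]big_mkcond; apply: eq_bigr => y _.
under eq_bigr do rewrite exprZn scalerA -exprM.
rewrite scaler_prod -expr_sum coefZ coefXn eq_sym /is_partition.
by case: eqP; rewrite ?mulr1 ?mulr0.
Qed.

(** Newton's identities in closed form: the elementary symmetric functions
    as polynomials in the power sums.  Both generating functions have
    logarithmic derivative [- \sum_(k < m) p_(k+1) 'X^k] modulo ['X^m]. *)
Lemma sum_prod_subsets_partitions (R : numFieldType) (I : finType)
    (b : I -> R) (m : nat) :
  \sum_(A : {set I} | #|A| == m) \prod_(i in A) b i =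
  (-1) ^+ m *
  \sum_(y : {ffun 'I_m -> 'I_m.+1} | is_partition y)
    \prod_(k < m)
      ((-1) ^+ y k / (y k)`!%:R *
       (k.+1%:R^-1 * \sum_i b i ^+ k.+1) ^+ y k).
Proof.
pose x k := - (k.+1%:R^-1 * \sum_i b i ^+ k.+1).
have logderiv_exp :
    log_deriv_mod m (\sum_(k < m) (x k *: 'X^(k.+1))^`())
                    (\prod_(k < m) exp_trunc m (x k *: 'X^(k.+1))).
  apply: log_deriv_mod_prod => k; apply: log_deriv_exp_trunc.
  by rewrite coefZ coefXn mulr0.
have logderiv_roots :
    log_deriv_mod m (\sum_(k < m) (x k *: 'X^(k.+1))^`())
                    (\prod_i (1 - b i *: 'X)).
  have -> : \sum_(k < m) (x k *: 'X^(k.+1))^`() =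
      \sum_i - \sum_(k < m) b i ^+ k.+1 *: 'X^k.
    rewrite sumrN exchange_big -sumrN; apply: eq_bigr => k _ /=.
    rewrite -scaler_suml derivZ derivXn /= -scaler_nat scalerA -scaleNr.
    by rewrite mulNr mulrAC mulVf ?mul1r // Num.Theory.pnatr_eq0.
  by apply: log_deriv_mod_prod => i; apply: log_deriv_geometric.
have const_coef : (\prod_i (1 - b i *: 'X))`_0 =
    (\prod_(k < m) exp_trunc m (x k *: 'X^(k.+1)))`_0.
  rewrite -!horner_coef0 !horner_prod !big1 // => [k _|i _].
    rewrite /exp_trunc horner_sum big_ord_recl big1 => [|j _].
      by rewrite expr0 invr1 scale1r hornerC addr0.
    rewrite hornerZ horner_exp hornerZ hornerXn expr0n mulr0 expr0n.
    by rewrite /= !mulr0.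
  by rewrite hornerD hornerC hornerN hornerZ hornerX mulr0 subr0.
have := log_deriv_mod_coef logderiv_roots logderiv_exp const_coef.
rewrite coef_prod_one_subX coef_prod_exp_trunc => /(congr1 ( *%R ((-1) ^+ m))).
rewrite mulrA -expr2 sqrr_sign mul1r => ->.
congr (_ * _); apply: eq_bigr => y _; apply: eq_bigr => k _.
by rewrite /x [in LHS]exprNn mulrA [_^-1 * _]mulrC.
Qed.

(** A finite set of ordinals has exactly one strictly increasing
    enumeration. *)
Lemma sum_sorted_tuples_subsets (R : comNzRingType) (n m : nat)
    (b : 'I_n.+1 -> R) :
  \sum_(N : m.-tuple 'I_n.+1 | sorted ltn [seq val k | k <- N])
    \prod_(j < m) b (tnth N j) =
  \sum_(A : {set 'I_n.+1} | #|A| == m) \prod_(i in A) b i.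
Proof.
have sorted_enum (A : {set 'I_n.+1}) : sorted ltn [seq val k | k <- enum A].
  have sorted_ord : sorted (relpre val ltn) (enum 'I_n.+1).
    by rewrite -sorted_map val_enum_ord iota_ltn_sorted.
  rewrite sorted_map /enum_mem -enumT; apply: sorted_filter sorted_ord.
  by move=> x y z; apply: ltn_trans.
(* The default tuple only serves the sets of cardinality other than [m],
   which the sum leaves out. *)
pose tup (A : {set 'I_n.+1}) : m.-tuple 'I_n.+1 :=
  insubd [tuple of nseq m ord0] (enum A).
pose supp (N : m.-tuple 'I_n.+1) : {set 'I_n.+1} := [set k in N].
have tupE (A : {set 'I_n.+1}) : #|A| == m -> tup A = enum A :> seq _.
  by move=> Am; rewrite /tup insubdK // unfold_in -cardE.
rewrite [RHS](reindex_onto supp tup) => [|A Am]; last first.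
  by apply/setP => k; rewrite inE -(mem_enum A) -tupE.
apply: eq_big => [N | N /(sorted_uniq ltn_trans ltnn) uN].
  apply/idP/andP => [sN | [Nm /eqP <-]]; last by rewrite tupE.
  have Nm : #|supp N| == m.
    have := sorted_uniq ltn_trans ltnn sN; rewrite (map_inj_uniq val_inj) => uN.
    by rewrite cardsE (card_uniqP uN) size_tuple.
  split=> //; apply/eqP/val_inj; rewrite /= tupE //.
  apply: (inj_map val_inj); apply: (irr_sorted_eq ltn_trans ltnn) => // i.
  by apply: eq_mem_map => k; rewrite mem_enum inE.
rewrite (map_inj_uniq val_inj) in uN.
rewrite -(big_tuple _ _ N xpredT) big_uniq //.
by apply: eq_bigl => k; rewrite inE.
Qed.

Theorem theorem3p1 (R : realType) (m q n : nat) (hqn : (q <= n)%N)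
    (a : nat -> R[i]) :
  \sum_(N : m.-tuple 'I_n.+1 | increasing_in q N) \prod_(j < m) a (tnth N j) =
  (-1) ^+ m *
  \sum_(y : {ffun 'I_m -> 'I_m.+1} | is_partition y)
    \prod_(i < m)
      ((-1) ^+ y i / (y i)`!%:R *
       (i.+1%:R^-1 * \sum_(q <= N < n.+1) a N ^+ i.+1) ^+ y i).
Proof.
(* Setting the terms of index below [q] to zero makes the lower bound
   disappear from both sides: a tuple with an entry below [q] contributes
   nothing, and the power sums have exponent at least [1]. *)
pose b (k : 'I_n.+1) := if (q <= k)%N then a k else 0.
have -> : \sum_(N : m.-tuple 'I_n.+1 | increasing_in q N)
      \prod_(j < m) a (tnth N j) =
    \sum_(N : m.-tuple 'I_n.+1 | sorted ltn [seq val k | k <- N])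
      \prod_(j < m) b (tnth N j).
  rewrite /increasing_in big_mkcondr; apply: eq_bigr => N _.
  case: ifP => [/all_tnthP qN | /negbT].
    by apply: eq_bigr => j _; rewrite /b qN.
  rewrite -has_predC => /has_tnthP [j qNj].
  by rewrite (bigD1 j) //= /b (negPf qNj) mul0r.
rewrite sum_sorted_tuples_subsets sum_prod_subsets_partitions.
congr (_ * _); apply: eq_bigr => y _; apply: eq_bigr => i _.
congr (_ * (_ * _) ^+ _); rewrite big_geq_mkord [RHS]big_mkcond /=.
by apply: eq_bigr => k _; rewrite /b; case: ifP; rewrite ?expr0n.
Qed.
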